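(* For every $d\ge 3$ there are constants $C,c>0$, depending only on $d$ (independent of $q$), such that for every power $q$ of an odd prime and every $E\subset\mathbb{F}_q^d$ with $|E|\ge C q^{\frac{d+2}{2}}$, the set of spreads determined by $E$ has at least $cq$ elements.
   Context: For $u,v\in\mathbb{F}_q^d$, $u\cdot v=\sum_i u_iv_i$ and $\|v\|=v\cdot v$. For $a,b$ with $\|a\|\ne0$, $\|b\|\ne 0$, the spread is $S(a,b)=1-\frac{(a\cdot b)^2}{\|a\|\,\|b\|}$ (undefined if $\|a\|=0$ or $\|b\|=0$). A triple $(a,b,c)$ of points generates spread $s$ if $S(a-b,c-b)$ is defined and equals $s$. The spreads determined by $E$ are the values $S(a-b,c-b)$ over triples of points $a,b,c\in E$ for which this is defined. *)

(* Defs.v *)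
From HB Require Import structures.
From mathcomp Require Import all_boot all_order all_algebra all_field.
Set Implicit Arguments. Unset Strict Implicit. Unset Printing Implicit Defensive.
Import Order.TTheory GRing.Theory Num.Theory.
Local Open Scope ring_scope.

Definition dotv (F : fieldType) (d : nat) (u v : 'rV[F]_d) : F :=
  \sum_(i < d) u 0 i * v 0 i.

Definition normv (F : fieldType) (d : nat) (v : 'rV[F]_d) : F := dotv v v.

(* spread S(a,b) = 1 - (a.b)^2 / (||a|| ||b||), meaningful when ||a||,||b|| != 0 *)
Definition spread (F : fieldType) (d : nat) (a b : 'rV[F]_d) : F :=
  1 - (dotv a b) ^+ 2 / (normv a * normv b).

Definition spread_defined (F : fieldType) (d : nat) (a b c : 'rV[F]_d) : bool :=
  (normv (a - b) != 0) && (normv (c - b) != 0).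

Definition spreads (F : finFieldType) (d : nat) (E : {set 'rV[F]_d}) : {set F} :=
  [set s | [exists a in E, exists b in E, exists c in E,
     spread_defined a b c && (s == spread (a - b) (c - b))]].

(* Main.v *)
(* Write N(z,t) for the number of y in P with z.y = t, and let
   excess(z) = q * sum_t N(z,t)^2 - |P|^2 >= 0.  Double counting the triples
   (z,y,y') with z.(y-y') = 0 gives sum_z excess(z) = |P| (q-1) q^D, so every
   set W of vectors contains some w with |W| excess(w) <= |P| (q-1) q^D.

   This is used twice.  Since ||a-b|| = ||a|| + ||b|| - 2 a.b, the condition
   ||a-b|| = 0 says that (a,||a||) in F^(d+1) lies on a hyperplane with normal
   (-2b,1); taking for W all nonzero multiples of these normals produces b in E
   such that ||a-b|| <> 0 for at least a third of the a in E.  Then let W be the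
   cone of nonzero multiples of these differences a-b.  By pigeonhole some
   nonzero r has at least |W|/(q-1) vectors of W on the sphere P = {||y|| = r},
   and a w in W of small excess takes at least q/2 values w.y on P.
   Spreads are invariant under scaling, so 1 - (w.y)^2 / (||w|| r) is a spread
   determined by E, and each spread arises from at most two values of w.y. *)
Require Import Defs.
From HB Require Import structures.
From mathcomp Require Import all_boot all_order all_algebra all_field.
From mathcomp Require Import ring lra.
Set Implicit Arguments.
Unset Strict Implicit.
Unset Printing Implicit Defensive.
Import Order.TTheory GRing.Theory Num.Theory.
Local Open Scope ring_scope.

(** * Variance and Cauchy-Schwarz over a finite set *)

(** Variance identity with denominators cleared. Discarding the whole left side gives
    Cauchy-Schwarz; keeping a single term bounds one deviation. *)
Lemma sum_sqr_dev (I : finType) (T : {set I}) (x : I -> rat) :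
  \sum_(t in T) (#|T|%:R * x t - \sum_(u in T) x u) ^+ 2
    = #|T|%:R * (#|T|%:R * \sum_(t in T) x t ^+ 2 - (\sum_(t in T) x t) ^+ 2).
Proof.
set S := \sum_(u in T) x u; set m : rat := #|T|%:R.
have -> : \sum_(t in T) (m * x t - S) ^+ 2
  = \sum_(t in T) (m ^+ 2 * x t ^+ 2 + (- (2 * m * S) * x t + S ^+ 2)).
  by apply: eq_bigr => t _; ring.
rewrite big_split big_split /= -!mulr_sumr sumr_const -/S -mulr_natr -/m; ring.
Qed.

Lemma sum_sqr_le (I : finType) (T : {set I}) (x : I -> rat) :
  (\sum_(t in T) x t) ^+ 2 <= #|T|%:R * \sum_(t in T) x t ^+ 2.
Proof.
have [->|T0] := eqVneq T set0; first by rewrite !big_set0 mulr0 expr0n.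
have m0 : 0 < #|T|%:R :> rat by rewrite ltr0n card_gt0.
rewrite -subr_ge0 -(pmulr_rge0 _ m0) -sum_sqr_dev.
by apply: sumr_ge0 => t _; apply: sqr_ge0.
Qed.

(** * Dot products, hyperplanes and the average excess *)

Section Fibers.
Variables (F : finFieldType) (D : nat).
Implicit Types (u v w y z : 'rV[F]_D) (P W : {set 'rV[F]_D}).

Lemma dotvE u v : dotv u v = (u *m v^T) 0 0.
Proof. by rewrite mxE; apply: eq_bigr => i _; rewrite mxE. Qed.

Lemma dotvC u v : dotv u v = dotv v u.
Proof. by apply: eq_bigr => i _; rewrite mulrC. Qed.

Lemma dotvDl u v y : dotv (u + v) y = dotv u y + dotv v y.
Proof. by rewrite !dotvE mulmxDl mxE. Qed.

Lemma dotvZl k u v : dotv (k *: u) v = k * dotv u v.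
Proof. by rewrite !dotvE -scalemxAl mxE. Qed.

Lemma dotvNl u v : dotv (- u) v = - dotv u v.
Proof. by rewrite -scaleN1r dotvZl mulN1r. Qed.

Lemma dotvZr k u v : dotv u (k *: v) = k * dotv u v.
Proof. by rewrite dotvC dotvZl dotvC. Qed.

Lemma dotvBr u v y : dotv u (v - y) = dotv u v - dotv u y.
Proof. by rewrite dotvC dotvDl dotvNl ![dotv _ u]dotvC. Qed.

Lemma normvZ k u : normv (k *: u) = k ^+ 2 * normv u.
Proof. by rewrite /normv dotvZl dotvZr mulrA. Qed.

Lemma normvB u v : normv (u - v) = normv u + normv v - 2 * dotv u v.
Proof.
by rewrite /normv dotvBr !dotvDl !dotvNl (dotvC v u); ring.
Qed.

(** Translation by [t *: e], where [e] has dot product 1 with [v], carries the zero slice onto the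
    slice at [t]; hence all slices have equal size. *)
Lemma card_hyperplane v : v != 0 ->
  (#|F| * #|[set z | dotv z v == 0%R]| = #|F| ^ D)%N.
Proof.
case/rV0Pn=> i vi; pose e : 'rV[F]_D := (v 0 i)^-1 *: delta_mx 0 i.
have ev : dotv e v = 1.
  rewrite dotvZl /dotv (bigD1 i) //= big1 => [|j ji].
    by rewrite !mxE !eqxx mul1r addr0 mulVf.
  by rewrite !mxE (negbTE ji) andbF mul0r.
have slice t : #|[set z | dotv z v == t]| = #|[set z | dotv z v == 0%R]|.
  rewrite -[RHS](card_imset _ (addIr (t *: e))); apply: eq_card => z.
  rewrite inE; apply/eqP/imsetP => [zt|[u]].
    exists (z - t *: e); last by rewrite subrK.
    by rewrite inE dotvDl dotvNl dotvZl ev zt mulr1 subrr.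
  by rewrite inE => /eqP u0 ->; rewrite dotvDl dotvZl u0 ev mulr1 add0r.
have := card_mx F 1 D; rewrite mul1n => <-.
rewrite -[RHS]sum1_card [RHS](partition_big (fun z => dotv z v) predT) //=.
rewrite -sum_nat_const; apply: eq_big => // t _.
by rewrite sum1dep_card -(slice t).
Qed.

Definition fiber P z (t : F) : nat := #|[set y in P | dotv z y == t]|.

(* This is [#|F| * \sum_t (fiber P z t - #|P| / #|F|) ^ 2], with denominators cleared. *)
Definition excess P z : rat :=
  #|F|%:R * (\sum_t (fiber P z t)%:R ^+ 2) - #|P|%:R ^+ 2.

Lemma sum_fiber P z : (\sum_t fiber P z t = #|P|)%N.
Proof.
rewrite -[RHS]sum1_card (partition_big (dotv z) predT) //=.
by apply: eq_bigr => t _; rewrite /fiber -sum1dep_card.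
Qed.

Lemma sqr_dev_le_excess P z t :
  (#|F|%:R * (fiber P z t)%:R - #|P|%:R) ^+ 2 <= #|F|%:R * excess P z.
Proof.
have := @sum_sqr_dev F [set: F] (fun t => (fiber P z t)%:R).
have -> : \sum_(u in [set: F]) (fiber P z u)%:R = #|P|%:R :> rat.
  by rewrite -(sum_fiber P z) natr_sum; apply: eq_bigl => u; rewrite inE.
have -> : \sum_(u in [set: F]) (fiber P z u)%:R ^+ 2
        = \sum_u (fiber P z u)%:R ^+ 2 :> rat.
  by apply: eq_bigl => u; rewrite inE.
rewrite cardsT -/(excess P z) => <-.
rewrite (bigD1 t) ?inE //= lerDl.
by apply: sumr_ge0 => u _; apply: sqr_ge0.
Qed.

Lemma excess_ge0 P z : 0 <= excess P z.
Proof.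
have q0 : 0 < #|F|%:R :> rat by rewrite ltr0n; apply/card_gt0P; exists 0.
rewrite -(pmulr_rge0 _ q0); apply: le_trans (sqr_dev_le_excess P z 0).
exact: sqr_ge0.
Qed.

Lemma sum_sqr_fiber P z :
  (\sum_t fiber P z t ^ 2 = \sum_(y in P) \sum_(y' in P) (dotv z (y' - y)%R == 0%R))%N.
Proof.
rewrite [RHS](partition_big (dotv z) predT) //=; apply: eq_bigr => t _.
rewrite (eq_bigr (fun=> fiber P z t)) => [|y /andP[_ /eqP yt]].
  by rewrite sum_nat_cond_const /fiber -mulnn.
rewrite -big_mkcondr /= sum1dep_card /fiber; apply: eq_card => y'.
by rewrite !inE dotvBr yt subr_eq0.
Qed.

Lemma sum_excess P :
  \sum_z excess P z = #|P|%:R * (#|F|%:R - 1) * #|F|%:R ^+ D.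
Proof.
(* For fixed y, the pair y' = y is counted by every z, and each other y' only by the z in a
   hyperplane. *)
have total : (#|F| * (\sum_z \sum_t fiber P z t ^ 2)
    = \sum_(y in P) (#|F| * #|F| ^ D + (#|P| - 1) * #|F| ^ D))%N.
  under eq_bigr => z _ do rewrite sum_sqr_fiber.
  rewrite exchange_big big_distrr /=; apply: eq_bigr => y yP.
  rewrite exchange_big (bigD1 y) //= mulnDr; congr addn.
    rewrite (eq_bigr (fun=> 1%N)) => [|z _]; last first.
      by rewrite subrr dotvC -(scale0r y) dotvZl mul0r eqxx.
    by rewrite sum1_card card_mx mul1n.
  rewrite big_distrr /= (eq_bigr (fun=> (#|F| ^ D)%N)) => [|y' /andP[_ ny]].
    rewrite sum_nat_cond_const; congr muln.
    have := cardsD1 y P; rewrite yP add1n => ->; rewrite subn1 /=.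
    by apply: eq_card => u; rewrite !inE andbC.
  rewrite -(@card_hyperplane (y' - y)) ?subr_eq0 //; congr muln.
  by rewrite -big_mkcond /= sum1dep_card.
have card_V : #|{: 'rV[F]_D}| = (#|F| ^ D)%N by rewrite card_mx mul1n.
rewrite sumrB sumr_const card_V -mulr_sumr.
have -> : \sum_z \sum_t (fiber P z t)%:R ^+ 2
    = (\sum_z \sum_t fiber P z t ^ 2)%N%:R :> rat.
  rewrite natr_sum; apply: eq_bigr => z _; rewrite natr_sum.
  by apply: eq_bigr => t _; rewrite natrX.
rewrite -natrM total sum_nat_const -[_ *+ (_ ^ _)]mulr_natr !natrM natrD !natrM natrX.
(* The empty set is treated apart because [#|P| - 1] is a truncated subtraction. *)
have [->|P0] := posnP #|P|; first by ring.
rewrite natrB //; ring.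
Qed.

Lemma exists_small_excess P W : W != set0 ->
  exists2 w, w \in W &
    #|W|%:R * excess P w <= #|P|%:R * (#|F|%:R - 1) * #|F|%:R ^+ D.
Proof.
case/set0Pn=> w0 w0W.
case: (@Order.TotalTheory.arg_minP _ _ _ w0 (mem W) (excess P) w0W) => w wW wmin.
exists w => //; rewrite -sum_excess (bigID (mem W)) /= mulr_natl -sumr_const.
rewrite -[leLHS]addr0 lerD ?sumr_ge0 // => [|z _]; last exact: excess_ge0.
by apply: ler_sum => z /wmin.
Qed.

End Fibers.

(** * Odd characteristic and counting values *)

Lemma odd_card_two_neq0 (F : finFieldType) : odd #|F| -> 2 != 0 :> F.
Proof.
move=> Fodd; apply/negP => two0.
have ch : 2%N \in [pchar F] by rewrite inE.
have := @card_pprimeChar _ F ch; rewrite [#|_|](_ : _ = #|F|) // => cF.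
have := finNzRing_gt1 F; move: Fodd; rewrite cF oddX orbF => /eqP ->.
by rewrite ltnn.
Qed.

Lemma card_le_double_imset (F : finFieldType) (f : F -> F) (T : {set F}) :
  (forall t u, f t = f u -> t = u \/ t = - u) -> (#|T| <= 2 * #|f @: T|)%N.
Proof.
(* [g] chooses a preimage; its default 0 is never reached on values of [f]. *)
move=> finj; pose g s := odflt 0 [pick t | f t == s].
have sub : T \subset g @: (f @: T) :|: [set - x | x in g @: (f @: T)].
  apply/subsetP => t tT.
  have gI : g (f t) \in g @: (f @: T) by rewrite !imset_f.
  have fg : f t = f (g (f t)).
    by rewrite /g; case: pickP => [u /eqP //|/(_ t)]; rewrite eqxx.
  rewrite inE; case: (finj _ _ fg) => ->; first by rewrite gI.
  by rewrite [X in _ || X]imset_f ?orbT.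
apply: leq_trans (subset_leq_card sub) _; apply: leq_trans (leq_card_setU _ _) _.
rewrite mul2n -addnn leq_add ?leq_imset_card //.
exact: leq_trans (leq_imset_card _ _) (leq_imset_card _ _).
Qed.

(** The fibers are supported on the image T, so Cauchy-Schwarz gives |P|^2 <= |T| sum N^2, while the
    excess bound gives q sum N^2 <= 2 |P|^2. *)
Lemma card_dotv_image (F : finFieldType) (D : nat) (P : {set 'rV[F]_D}) w :
  P != set0 -> excess P w <= #|P|%:R ^+ 2 ->
  (#|F| <= 2 * #|[set dotv w y | y in P]|)%N.
Proof.
move=> P0 small; set T := [set _ | _ in _].
have outT t : t \notin T -> fiber P w t = 0%N.
  move=> tT; apply: eq_card0 => y; rewrite !inE; apply/negP => /andP[yP /eqP yt].
  by case/negP: tT; rewrite -yt imset_f.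
have s1 : \sum_(t in T) (fiber P w t)%:R = #|P|%:R :> rat.
  rewrite -(sum_fiber P w) natr_sum big_mkcond /=; apply: eq_bigr => t _.
  by case: ifPn => // /outT ->.
have s2 : \sum_(t in T) (fiber P w t)%:R ^+ 2 = \sum_t (fiber P w t)%:R ^+ 2 :> rat.
  by rewrite big_mkcond /=; apply: eq_bigr => t _; case: ifPn => // /outT ->.
have := @sum_sqr_le _ T (fun t => (fiber P w t)%:R); rewrite s1 s2.
move: small; rewrite /excess; set S := \sum_t _ => small CS.
have Pp : 0 < #|P|%:R ^+ 2 :> rat by rewrite exprn_gt0 // ltr0n card_gt0.
rewrite -(ler_nat rat) natrM -(ler_pM2r Pp).
have := ler_wpM2l (ler0n rat #|F|) CS; have := ler_wpM2l (ler0n rat #|T|) small.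
lra.
Qed.

(** * Choosing the pin by lifting to a paraboloid *)

Lemma exists_anisotropic_pin (F : finFieldType) (d : nat) (E : {set 'rV[F]_d}) :
  odd #|F| -> E != set0 ->
  9%:R * #|F|%:R ^+ (d + 2) <= #|E|%:R ^+ 2 :> rat ->
  exists2 b, b \in E & (#|E| <= 3 * #|[set a in E | normv (a - b)%R != 0%R]|)%N.
Proof.
move=> Fodd E0 Elarge; have two0 := odd_card_two_neq0 Fodd.
have q3 : (3 <= #|F|)%N.
  by have := finNzRing_gt1 F; rewrite leq_eqVlt => /orP[/eqP q2|//]; rewrite -q2 in Fodd.
pose lift (a : 'rV[F]_d) : 'rV[F]_(d + 1) := row_mx a (const_mx (normv a)).
pose dual (p : F * 'rV[F]_d) : 'rV[F]_(d + 1) :=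
  p.1 *: row_mx (- 2 *: p.2) (const_mx 1).
have dual_lift k b a : dotv (dual (k, b)) (lift a) = k * (normv (a - b) - normv b).
  rewrite dotvZl /dotv big_split_ord big_ord1 /= !row_mxEr !mxE mul1r; congr (_ * _).
  under eq_bigr => i _ do rewrite !row_mxEl.
  by rewrite -/(dotv _ _) dotvZl normvB (dotvC b a); ring.
have lift_inj : injective lift by move=> a a' /eq_row_mx[].
pose W := dual @: setX [set~ 0] E.
(* The last coordinate recovers k; then b is recovered because 2 is invertible. *)
have dual_inj : {in setX [set~ 0] E &, injective dual}.
  move=> [k b] [k' b']; rewrite !inE /= => /andP[k0 _] /andP[k'0 _].
  rewrite /dual /= !scale_row_mx => /eq_row_mx[eb /matrixP/(_ 0 0)].
  rewrite !mxE !mulr1 => ek; congr pair => //; move: eb.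
  rewrite ek !scalerA; apply: scalerI.
  by rewrite mulf_neq0 // oppr_eq0.
have cardW : #|W| = (#|F|.-1 * #|E|)%N.
  by rewrite card_in_imset // cardsX cardsC1.
have W0 : W != set0.
  by rewrite -card_gt0 cardW muln_gt0 card_gt0 E0 andbT -ltnS prednK // ltnW // ltnW.
have [w] := exists_small_excess (lift @: E) W0.
case/imsetP => -[k b]; rewrite !inE /= => /andP[k0 bE] ->.
rewrite cardW (card_imset _ lift_inj) natrM => small.
exists b => //; set A := [set a in E | _]; pose N := E :\: A.
(* The isotropic differences from b form exactly one fiber of the lifted set. *)
have fibN : fiber (lift @: E) (dual (k, b)) (- (k * normv b)) = #|N|.
  rewrite -(card_imset N lift_inj) /fiber; apply: eq_card => y; rewrite inE.
  apply/andP/imsetP => [[/imsetP[a aE ->]]|[a]].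
    rewrite dual_lift mulrBr -[X in _ == X]add0r (inj_eq (addIr _)) mulf_eq0 (negbTE k0) /=.
    by move=> a0; exists a; rewrite // !inE aE a0.
  rewrite !inE negb_and negbK => /andP[] /orP[/negbTE->//|a0] aE ->.
  by rewrite imset_f // dual_lift (eqP a0) sub0r mulrN.
have := @sqr_dev_le_excess _ _ (lift @: E) (dual (k, b)) (- (k * normv b)).
rewrite fibN (card_imset _ lift_inj) => dev.
have cardN : (#|N| + #|A| = #|E|)%N.
  rewrite -(cardsID A E) addnC; congr addn.
  by apply: eq_card => a; rewrite !inE andbA andbb.
have e0 : 0 < #|E|%:R :> rat by rewrite ltr0n card_gt0.
have qm1 : #|F|.-1%:R = #|F|%:R - 1 :> rat by rewrite -subn1 natrB // ltnW // ltnW.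
have q3R : 3%:R <= #|F|%:R :> rat by rewrite ler_nat.
move: small dev Elarge; rewrite qm1 !exprD !expr1 -(ler_nat rat) natrM.
have -> : #|A|%:R = #|E|%:R - #|N|%:R :> rat by rewrite -cardN natrD addrC addKr.
move: (excess _ _) (#|F|%:R ^+ d) q3R e0.
move: #|F|%:R #|E|%:R #|N|%:R (ler0n rat #|N|) => q e n n0 X Q q3R e0 small dev Elarge.
have X_le : X <= Q * q.
  have c0 : 0 < (q - 1) * e by rewrite mulr_gt0 //; lra.
  by rewrite -(ler_pM2l c0) [_ * (Q * q)](_ : _ = e * (q - 1) * (Q * q)) //; ring.
(* From (qn - e)^2 <= qX <= Q q^2 <= e^2 / 9. Then qn <= 4e/3, and q >= 3 gives n <= 4e/9, which
   leaves more than e/3 points. *)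
have dev9 : (3 * (q * n - e)) ^+ 2 <= e ^+ 2.
  have := ler_wpM2l (_ : 0 <= q) X_le; rewrite (le_trans _ q3R) // => /(_ isT) qX.
  rewrite exprMn; lra.
have qn : 3 * (q * n - e) <= e.
  apply: le_trans (ler_norm _) _; rewrite -(ler_pXn2r (ltn0Sn 1)) ?nnegrE ?normr_ge0 ?(ltW e0) //.
  by rewrite real_normK ?num_real.
have := ler_wpM2r n0 q3R; lra.
Qed.

(** * Spreads at the pin *)

(** Applied with m = |W|, p = |P|, Q = q^d. The last two hypotheses give Q q^2 <= m^2, whence m^2 X
    <= m p (q-1) Q <= p^2 (q-1)^2 Q <= p^2 q^2 Q <= p^2 m^2. *)
Lemma small_excess_arith (q e m p X Q : rat) :
  0 <= X -> 0 <= Q -> 0 < m -> 1 <= q -> 0 <= p -> 0 <= e ->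
  m <= (q - 1) * p -> m * X <= p * (q - 1) * Q ->
  9%:R * (Q * q ^+ 2) <= e ^+ 2 -> e <= 3 * m -> X <= p ^+ 2.
Proof.
move=> X0 Q0 m0 q1 p0 e0 mp mX Qe em.
have m2 : Q * q ^+ 2 <= m ^+ 2.
  have : e ^+ 2 <= (3 * m) ^+ 2.
    by apply: lerXn2r => //; rewrite nnegrE mulr_ge0 // ltW.
  by rewrite exprMn; lra.
have pqQ : 0 <= p * (q - 1) * Q by rewrite !mulr_ge0 // subr_ge0.
have m2p : 0 < m ^+ 2 by rewrite exprn_gt0.
rewrite -(ler_pM2l m2p).
have s1 := ler_wpM2l (ltW m0) mX.
have s2 := ler_wpM2r pqQ mp.
have s3 := ler_wpM2r (sqr_ge0 p) m2.
have s4 : p ^+ 2 * Q * (q - 1) ^+ 2 <= p ^+ 2 * Q * q ^+ 2.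
  apply: ler_wpM2l; first by rewrite mulr_ge0 ?sqr_ge0.
  by apply: lerXn2r; rewrite ?nnegrE; lra.
lra.
Qed.

Lemma card_spreads_pin (F : finFieldType) (d : nat) (E : {set 'rV[F]_d}) b :
  b \in E -> E != set0 ->
  9%:R * #|F|%:R ^+ (d + 2) <= #|E|%:R ^+ 2 :> rat ->
  (#|E| <= 3 * #|[set a in E | normv (a - b)%R != 0%R]|)%N ->
  (#|F| <= 4 * #|spreads E|)%N.
Proof.
move=> bE E0 Elarge; set A := [set a in E | _] => EA.
pose W := [set p.1 *: (p.2 - b) | p in setX [set~ 0] A].
have WP w : w \in W -> exists k a,
    [/\ k != 0, a \in E, normv (a - b) != 0 & w = k *: (a - b)].
  case/imsetP => -[k a]; rewrite !inE /= => /andP[k0 /andP[aE a0]] ->.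
  by exists k, a.
have AW : (#|A| <= #|W|)%N.
  rewrite -(card_imset A (addIr (- b))); apply: subset_leq_card.
  apply/subsetP => _ /imsetP[a aA ->]; rewrite -[_ - _]scale1r.
  by apply/imsetP; exists (1, a); rewrite // !inE oner_eq0; move: aA; rewrite inE.
have Wn w : w \in W -> normv w != 0.
  by case/WP => k [a [k0 _ a0 ->]]; rewrite normvZ mulf_neq0 // expf_neq0.
have W0 : W != set0.
  rewrite -card_gt0; move: E0; rewrite -card_gt0 => E0.
  by apply: leq_trans AW; move: (leq_trans E0 EA); rewrite muln_gt0.
pose P r := [set w in W | normv w == r].
(* All norms on [W] are nonzero, so q - 1 spheres cover [W]; take the largest. *)
have [r r0 Pr] : exists2 r : F, r != 0 & (#|W| <= #|F|.-1 * #|P r|)%N.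
  case: (@arg_maxnP _ 1 (fun r : F => r != 0) (fun r => #|P r|)); first exact: oner_neq0.
  move=> r r0 rmax; exists r => //.
  rewrite -sum1_card (partition_big (@normv F d) (fun r => r != 0)) //=.
  rewrite -(cardsC1 (0 : F)) -sum_nat_const.
  rewrite [leqRHS](eq_bigl (fun r => r != 0)) => [|s]; last by rewrite !inE.
  apply: leq_sum => s s0; apply: leq_trans (rmax s s0).
  by rewrite -sum1_card /P; apply: eq_leq; apply: eq_bigl => w; rewrite inE.
have P0 : P r != set0.
  move: W0; rewrite -!card_gt0 => W0.
  by move: (leq_trans W0 Pr); rewrite muln_gt0 => /andP[].
have [w wW small] := exists_small_excess (P r) W0.
have smallP : excess (P r) w <= #|P r|%:R ^+ 2.
  have w0 : 0 < #|W|%:R :> rat by rewrite ltr0n card_gt0.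
  have q1 : (0 < #|F|)%N by apply/card_gt0P; exists 0.
  have q0 : 1 <= #|F|%:R :> rat by rewrite ler1n.
  have EW : #|E|%:R <= 3 * #|W|%:R :> rat.
    by rewrite -natrM ler_nat (leq_trans EA) // leq_mul2l.
  have Qn : 0 <= #|F|%:R ^+ d :> rat by rewrite exprn_ge0.
  have X0 := excess_ge0 (P r) w.
  move: Pr small Elarge EW; rewrite -(ler_nat rat) natrM exprD.
  rewrite -subn1 natrB //.
  have := ler0n rat #|E|; have := ler0n rat #|P r|.
  exact: small_excess_arith X0 Qn w0 q0.
have := card_dotv_image P0 smallP; set T := [set _ | _ in P r] => FT.
have nw := Wn w wW.
pose f (t : F) := 1 - t ^+ 2 / (normv w * r).
have f_inj t u : f t = f u -> t = u \/ t = - u.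
  have nr : (normv w * r)^-1 != 0 by rewrite invr_eq0 mulf_neq0.
  move/addrI/oppr_inj/(mulIf nr)/eqP; rewrite eqf_sqr.
  by case/orP => /eqP; [left|right].
(* Both [w] and [y] are nonzero multiples of differences from [b], and the scalars cancel in the
   spread. *)
have fT : f @: T \subset spreads E.
  apply/subsetP => _ /imsetP[_ /imsetP[y + ->] ->]; rewrite inE => /andP[yW /eqP yr].
  case/WP: wW nw => k [a [k0 aE a0 wE]] nw.
  case/WP: yW yr => l [c [l0 cE c0 yE]] yr.
  rewrite inE; apply/existsP; exists a; rewrite aE /=.
  apply/existsP; exists b; rewrite bE /=; apply/existsP; exists c; rewrite cE /=.
  rewrite /spread_defined a0 c0 /= /f -yr wE yE /spread !normvZ dotvZl dotvZr.
  by apply/eqP; field; rewrite k0 l0 a0 c0.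
(* One factor 2 comes from the number of dot products, the other from the sign lost in squaring. *)
apply: leq_trans FT _; rewrite -[4%N]/(2 * 2)%N -mulnA leq_mul2l /=.
have fT2 := leq_mul (leqnn 2) (subset_leq_card fT).
exact: leq_trans (card_le_double_imset T f_inj) fT2.
Qed.

Unset Implicit Arguments.

(* |E| >= C q^((d+2)/2) is written equivalently (C > 0) as |E|^2 >= C^2 q^(d+2). *)
Theorem theorem6p2 (d : nat) (hd : (3 <= d)%N) :
  exists C c : rat, 0 < C /\ 0 < c /\
    forall (F : finFieldType), odd #|F| ->
    forall E : {set 'rV[F]_d},
      (#|E|%:R) ^+ 2 >= C ^+ 2 * (#|F|%:R) ^+ (d + 2) ->
      (#|spreads E|%:R : rat) >= c * #|F|%:R.
Proof.
(* C = 3 supplies the factor 9 used for both the pin and the sphere; c = 1/4 is the loss of two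
   factors 2. *)
exists 3, (1 / 4); do 2!split=> //; move=> F Fodd E.
have -> : 3 ^+ 2 = 9%:R :> rat by ring.
move=> Elarge.
have E0 : E != set0.
  apply: contraTneq Elarge => ->; rewrite cards0 expr0n -ltNge mulr_gt0 //.
  by rewrite exprn_gt0 // ltr0n; apply/card_gt0P; exists 0.
have [b bE EA] := exists_anisotropic_pin Fodd E0 Elarge.
have := card_spreads_pin bE E0 Elarge EA.
rewrite -(ler_nat rat) natrM; lra.
Qed.
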